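(* Let $A,B,C\in\mathbb{C}^{n\times n}$. If the $crCR$-inverse $A_{B,C}$ of $A$ exists, then $A_{B,C}=A^{(E,F)}$, where $E=P_{\mathcal{R}(B),\mathcal{N}(CA)}$ and $F=P_{\mathcal{R}(AB),\mathcal{N}(C)}$.
   Context: $\mathcal{R}(M)$ and $\mathcal{N}(M)$ denote the column space and null space of a matrix $M$, and $M^*$ its conjugate transpose. $P_{\mathcal{M},\mathcal{N}}$ denotes the projector (idempotent matrix) onto the subspace $\mathcal{M}$ along the subspace $\mathcal{N}$ (where the two subspaces are complementary). $crCR$-inverse: for $A,B,C\in\mathbb{C}^{n\times n}$, the $crCR$-inverse of $A$ is a matrix $X\in\mathbb{C}^{n\times n}$ satisfying: $\mathcal{R}(X)\subseteq\mathcal{R}(B)$; $\mathcal{R}(X^* )\subseteq\mathcal{R}(C^* )$; $XA$ is the identity on $\mathcal{R}(B)$ (i.e. $XAB=B$); and $(AX)^*$ is the identity on $\mathcal{R}(C^* )$ (i.e. $CAX=C$). When it exists it is unique and is denoted $A_{B,C}$. $EF$-inverse: for $A\in\mathbb{C}^{m\times n}$, $E\in\mathbb{C}^{n\times n}$, $F\in\mathbb{C}^{m\times m}$, an $EF$-inverse of $A$ is a matrix $X\in\mathbb{C}^{n\times m}$ with $XAX=X$, $XA=E$ and $AX=F$. When it exists it is unique and is denoted $A^{(E,F)}$. The asserted equality includes the existence of $A^{(E,F)}$. *)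

(* Defs.v *)
From HB Require Import structures.
From mathcomp Require Import all_boot all_order all_algebra.
From mathcomp Require Import complex reals.

Set Implicit Arguments.
Unset Strict Implicit.
Unset Printing Implicit Defensive.

Import Order.TTheory GRing.Theory Num.Theory.
Local Open Scope ring_scope.
Local Open Scope sesquilinear_scope.

(* The subspaces R(M) and N(M) are taken inside the column vectors: a matrix   *)
(* acts on the left, unlike in mxalgebra, where it acts on row vectors.        *)
Definition colspace (K : fieldType) (m n : nat) (M : 'M[K]_(m, n)) :
  {vspace 'cV[K]_m} := limg (linfun (mulmx M : 'cV[K]_n -> 'cV[K]_m)).

Definition nullspace (K : fieldType) (m n : nat) (M : 'M[K]_(m, n)) :
  {vspace 'cV[K]_n} := lker (linfun (mulmx M : 'cV[K]_n -> 'cV[K]_m)).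

Definition complementary (K : fieldType) (vT : vectType K)
    (U V : {vspace vT}) : Prop :=
  (U :&: V = 0)%VS /\ (U + V = fullv)%VS.

(* P_{U,V}: the matrix, in the canonical basis, of the projection onto U along *)
(* V; it is meaningful only when [complementary U V].                          *)
Definition projmx (K : fieldType) (n : nat) (U V : {vspace 'cV[K]_n}) :
  'M[K]_n := \matrix_(i, j) daddv_pi U V (delta_mx j 0) i 0.

Definition crCR_inverse (K : numClosedFieldType) (n : nat)
    (A B C X : 'M[K]_n) : Prop :=
  [/\ (colspace X <= colspace B)%VS,
      (colspace (X ^t*) <= colspace (C ^t*))%VS,
      {in colspace B, forall v, (X *m A) *m v = v} &
      {in colspace (C ^t*), forall v, (A *m X) ^t* *m v = v}].

Definition EF_inverse (K : fieldType) (m n : nat) (A : 'M[K]_(m, n))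
    (E : 'M[K]_n) (F : 'M[K]_m) (X : 'M[K]_(n, m)) : Prop :=
  [/\ X *m A *m X = X, X *m A = E & A *m X = F].

Lemma colspaceP (K : fieldType) (m n : nat) (M : 'M[K]_(m, n)) (v : 'cV[K]_m) :
  reflect (exists w : 'cV[K]_n, v = M *m w) (v \in colspace M).
Proof.
apply: (iffP memv_imgP) => [[w _ ->]|[w ->]]; exists w; rewrite ?lfunE //.
exact: memvf.
Qed.

Lemma nullspaceP (K : fieldType) (m n : nat) (M : 'M[K]_(m, n))
    (v : 'cV[K]_n) :
  reflect (M *m v = 0) (v \in nullspace M).
Proof. by rewrite memv_ker lfunE; exact: eqP. Qed.

Lemma projmxE (K : fieldType) (n : nat) (U V : {vspace 'cV[K]_n})
    (v : 'cV[K]_n) :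
  projmx U V *m v = daddv_pi U V v.
Proof.
rewrite [in RHS](matrix_sum_delta v) linear_sum.
apply/colP => i; rewrite summxE mxE; apply: eq_bigr => j _.
by rewrite big_ord1 linearZ !mxE mulrC.
Qed.

Lemma projmx_projector (K : fieldType) (n : nat) (U V : {vspace 'cV[K]_n}) :
  complementary U V ->
  [/\ projmx U V *m projmx U V = projmx U V,
      colspace (projmx U V) = U & nullspace (projmx U V) = V].
Proof.
case=> UV0 UVf; have VU0 : (V :&: U = 0)%VS by rewrite capvC.
have dec v : daddv_pi U V v + daddv_pi V U v = v.
  by apply: daddv_pi_add; rewrite ?UVf ?memvf.
split.
- have eqM (M N : 'M[K]_n) : (forall v : 'cV_n, M *m v = N *m v) -> M = N.
    move=> eqMN; apply/matrixP => i j.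
    by have := eqMN (delta_mx j 0); rewrite -!colE => /colP/(_ i); rewrite !mxE.
  by apply: eqM => v; rewrite -mulmxA !projmxE daddv_pi_proj.
- apply/vspaceP => v; apply/colspaceP/idP => [[w ->]|Uv].
    by rewrite projmxE memv_pi.
  by exists v; rewrite projmxE daddv_pi_id.
- apply/vspaceP => v; apply/nullspaceP/idP; rewrite projmxE; last first.
    move=> Vv; apply: (addIr (daddv_pi V U v)).
    by rewrite dec add0r daddv_pi_id.
  by move=> pv0; rewrite -(dec v) pv0 add0r memv_pi.
Qed.

Lemma crCR_inverse_uniq (K : numClosedFieldType) (n : nat)
    (A B C X Y : 'M[K]_n) :
  crCR_inverse A B C X -> crCR_inverse A B C Y -> X = Y.
Proof.
have fix_sub (M N P : 'M[K]_n) : {in colspace N, forall v, M *m v = v} ->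
    (colspace P <= colspace N)%VS -> M *m P = P.
  move=> MN /subvP sPN; apply/matrixP => i j.
  have Pj : col j P \in colspace N.
    by apply/sPN/colspaceP; exists (delta_mx j 0); rewrite colE.
  have := MN _ Pj; rewrite colE mulmxA -!colE => /colP/(_ i).
  by rewrite [LHS]mxE => ->; rewrite mxE.
case=> sXB _ _ AXC [_ sYC YAB _].
have YAX : Y *m A *m X = X by exact: fix_sub YAB sXB.
have := fix_sub _ _ _ AXC sYC.
rewrite -map_mxM -trmx_mul mulmxA YAX => eqXY.
by apply: trmx_inj; apply: (map_mx_inj (f := Num.conj)).
Qed.

Lemma EF_inverse_uniq (K : fieldType) (m n : nat) (A : 'M[K]_(m, n))
    (E : 'M[K]_n) (F : 'M[K]_m) (X Y : 'M[K]_(n, m)) :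
  EF_inverse A E F X -> EF_inverse A E F Y -> X = Y.
Proof.
case=> XAX XA AX [YAY YA AY].
by rewrite -XAX -mulmxA AX -AY mulmxA XA -YA YAY.
Qed.

(* Main.v *)
Require Import Defs.
From HB Require Import structures.
From mathcomp Require Import all_boot all_order all_algebra.
From mathcomp Require Import complex reals.

Set Implicit Arguments.
Unset Strict Implicit.
Unset Printing Implicit Defensive.

Import Order.TTheory GRing.Theory Num.Theory.
Local Open Scope ring_scope.
Local Open Scope complex_scope.

(** The four conditions defining the crCR-inverse are matrix identities:
    inclusion of column spaces is factorization ([colspace_subP]), so
    the two inclusions say [X = B W] and, after taking adjoints, [X = Z C],
    while the two identity conditions say [X A B = B] and [C A X = C]
    ([crCR_inverse_eqs]).  Hence [X A X = X A B W = B W = X], and both [X A] and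
    [A X] are idempotent.

    An idempotent is the projector onto its column space along its null space
    ([idempotent_projmx]), so it remains to identify these spaces.  Each of the
    four equalities is a pair of mutual factorizations:
    [X A = B (W A)] and [B = (X A) B];  [X A = Z (C A)] and [C A = (C A) (X A)];
    [A X = (A B) W] and [A B = (A X) (A B)];  [A X = (A Z) C] and
    [C = C (A X)]. *)

(** The columns of [M] lie in the column space of [N], and a preimage of each
    one under [N] gives a column of [W]. *)
Lemma colspace_subP (K : fieldType) (m n p : nat)
    (M : 'M[K]_(m, n)) (N : 'M[K]_(m, p)) :
  reflect (exists W, M = N *m W) (colspace M <= colspace N)%VS.
Proof.
apply: (iffP subvP) => [sMN | [W ->] _ /colspaceP[w ->]]; last first.
  by apply/colspaceP; exists (W *m w); rewrite mulmxA.
have colN j : exists w : 'cV[K]_p, col j M = N *m w.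
  by apply/colspaceP/sMN/colspaceP; exists (delta_mx j 0); rewrite colE.
have [w Mw] := fin_all_exists colN.
exists (\matrix_(k, j) w j k 0); apply/matrixP => i j.
have /colP/(_ i) := Mw j; rewrite !mxE => ->.
by apply: eq_bigr => k _; rewrite mxE.
Qed.

Lemma eq_colspace (K : fieldType) (m n p : nat)
    (M : 'M[K]_(m, n)) (N : 'M[K]_(m, p)) W W' :
  M = N *m W -> N = M *m W' -> colspace M = colspace N.
Proof.
move=> MNW NMW; apply/eqP; rewrite eqEsubv.
by apply/andP; split; apply/colspace_subP; [exists W | exists W'].
Qed.

Lemma eq_nullspace (K : fieldType) (m n p : nat)
    (M : 'M[K]_(m, n)) (N : 'M[K]_(p, n)) Z Z' :
  M = Z *m N -> N = Z' *m M -> nullspace M = nullspace N.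
Proof.
move=> MZN NZM; apply/vspaceP => v.
apply/nullspaceP/nullspaceP => v0; [rewrite NZM | rewrite MZN];
  by rewrite -mulmxA v0 mulmx0.
Qed.

Lemma fix_colspaceP (K : fieldType) (m n : nat)
    (P : 'M[K]_m) (M : 'M[K]_(m, n)) :
  {in colspace M, forall v, P *m v = v} <-> P *m M = M.
Proof.
split=> [fixM | PM _ /colspaceP[w ->]]; last by rewrite mulmxA PM.
apply/matrixP => i j.
have /fixM : col j M \in colspace M.
  by apply/colspaceP; exists (delta_mx j 0); rewrite colE.
by rewrite colE mulmxA -!colE => /colP/(_ i); rewrite !mxE.
Qed.

(** The spaces meet trivially because [P] fixes the first and kills the second;
    they span because [v = P v + (v - P v)]. *)
Lemma idempotent_complementary (K : fieldType) (n : nat) (P : 'M[K]_n) :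
  P *m P = P -> complementary (colspace P) (nullspace P).
Proof.
move=> PP; split; apply/eqP.
  rewrite -subv0; apply/subvP => v; rewrite memv_cap memv0.
  by case/andP=> /colspaceP[w ->] /nullspaceP; rewrite mulmxA PP => ->.
rewrite eqEsubv subvf; apply/subvP => v _.
rewrite -[v](subrKC (P *m v)); apply: memv_add.
  by apply/colspaceP; exists v.
by apply/nullspaceP; rewrite mulmxBr mulmxA PP subrr.
Qed.

(** The projector [Q] fixes the range of [P] and kills the range of [1 - P], so
    [Q = Q P + Q (1 - P) = P]. *)
Lemma idempotent_projmx (K : fieldType) (n : nat) (P : 'M[K]_n) :
  P *m P = P -> projmx (colspace P) (nullspace P) = P.
Proof.
move=> PP; have cUV := idempotent_complementary PP.
have [_ _ nullQ] := projmx_projector cUV.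
set Q := projmx _ _ in nullQ *.
have QP : Q *m P = P.
  apply/fix_colspaceP => v Pv.
  by rewrite projmxE daddv_pi_id //; case: cUV.
rewrite -[RHS]QP; apply/eqP; rewrite -subr_eq0 -{1}[Q]mulmx1 -mulmxBr.
apply/eqP/matrixP => i j.
have /nullspaceP : col j (1%:M - P) \in nullspace Q.
  rewrite nullQ; apply/nullspaceP.
  by rewrite colE mulmxA mulmxBr mulmx1 PP subrr mul0mx.
by rewrite colE mulmxA -colE => /colP/(_ i); rewrite !mxE.
Qed.

Lemma adjmx_mul (K : numClosedFieldType) (m n p : nat)
    (M : 'M[K]_(m, n)) (N : 'M[K]_(n, p)) :
  ((M *m N) ^t* = N ^t* *m M ^t*)%sesqui.
Proof. by rewrite trmx_mul map_mxM. Qed.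

Lemma adjmx_inj (K : numClosedFieldType) (m n : nat) :
  injective (fun M : 'M[K]_(m, n) => (M ^t*)%sesqui).
Proof. by move=> M N /map_mx_inj/trmx_inj. Qed.

(** Taking adjoints turns the two conditions on [C], which concern row spaces,
    into identities that multiply [C] on the other side. *)
Lemma crCR_inverse_eqs (K : numClosedFieldType) (n : nat)
    (A B C X : 'M[K]_n) :
  crCR_inverse A B C X ->
  [/\ exists W, X = B *m W, exists Z, X = Z *m C,
      X *m A *m B = B & C *m A *m X = C].
Proof.
case=> /colspace_subP XB /colspace_subP[Z XC] /fix_colspaceP XAB.
move=> /fix_colspaceP AXC; split=> //.
  exists (Z ^t*)%sesqui; apply: adjmx_inj.
  by rewrite /= adjmx_mul trmxCK.
by apply: adjmx_inj; rewrite /= -mulmxA adjmx_mul.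
Qed.

Theorem corollary2p10 (R : realType) (n : nat) (A B C X : 'M[R[i]]_n) :
  crCR_inverse A B C X ->
  [/\ complementary (colspace B) (nullspace (C *m A)),
      complementary (colspace (A *m B)) (nullspace C) &
      EF_inverse A (projmx (colspace B) (nullspace (C *m A)))
                   (projmx (colspace (A *m B)) (nullspace C)) X].
Proof.
case/crCR_inverse_eqs => -[W XBW] [Z XZC] XAB CAX.
have XAX : X *m A *m X = X by rewrite {2 3}XBW mulmxA XAB.
have idE : X *m A *m (X *m A) = X *m A by rewrite mulmxA XAX.
have idF : A *m X *m (A *m X) = A *m X by rewrite -mulmxA (mulmxA X) XAX.
have colE : colspace (X *m A) = colspace B.
  by apply: (@eq_colspace _ _ _ _ _ _ (W *m A) B); rewrite // mulmxA -XBW.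
have nullE : nullspace (X *m A) = nullspace (C *m A).
  apply: (@eq_nullspace _ _ _ _ _ _ Z (C *m A)); first by rewrite mulmxA -XZC.
  by rewrite mulmxA CAX.
have colF : colspace (A *m X) = colspace (A *m B).
  apply: (@eq_colspace _ _ _ _ _ _ W (A *m B)); first by rewrite -mulmxA -XBW.
  by rewrite -mulmxA (mulmxA X) XAB.
have nullF : nullspace (A *m X) = nullspace C.
  apply: (@eq_nullspace _ _ _ _ _ _ (A *m Z) C); first by rewrite -mulmxA -XZC.
  by rewrite mulmxA CAX.
rewrite -colE -nullE -colF -nullF.
split; [exact: idempotent_complementary | exact: idempotent_complementary |].
by split; rewrite ?idempotent_projmx.
Qed.
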